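(* Let $\boldsymbol{\pi}\in\mathbb{R}^n$ be a vector with positive entries such that $\boldsymbol{\pi}^T\mathbf{1}=1$, let $f:\mathbb{S}_n^{\boldsymbol{\pi}}\to\mathbb{R}$ be a smooth function, and let $S\in\mathbb{S}_n^{\boldsymbol{\pi}}$. The Riemannian gradient $\operatorname{grad}f(S)$, with respect to the Fisher metric, is expressed in terms of the Euclidean gradient $\operatorname{Grad}f(S)$ as $$\operatorname{grad}f(S) = \Pi_S(\operatorname{Grad}f(S) \odot S).$$
   Context: $\mathbf{1}=(1,\ldots,1)^T\in\mathbb{R}^n$; $\odot$ and $\oslash$ denote entrywise (Hadamard) multiplication and division; $S>0$ means all entries are positive. $\mathbb{S}_n^{\boldsymbol{\pi}} = \{ S \in \mathbb{R}^{n \times n} : S \mathbf{1} = \mathbf{1},\ \boldsymbol{\pi}^T S = \boldsymbol{\pi}^T,\ S > 0 \}$ is an embedded submanifold of $\mathbb{R}^{n\times n}$ whose tangent space at $S$ is $\mathcal{T}_S \mathbb{S}_n^{\boldsymbol{\pi}} = \{ \xi \in \mathbb{R}^{n \times n} : \xi \mathbf{1} = \mathbf{0},\ \boldsymbol{\pi}^T \xi = \mathbf{0}^T \}$. It is endowed with the Fisher metric $\langle \xi,\eta\rangle_S=\sum_{i,j=1}^n \frac{\xi_{i,j}\eta_{i,j}}{S_{i,j}}=\operatorname{Trace}((\xi\oslash S)\eta^T)$, a formula which defines an inner product on all of $\mathbb{R}^{n\times n}$; $\Pi_S:\mathbb{R}^{n\times n}\to\mathcal{T}_S\mathbb{S}_n^{\boldsymbol{\pi}}$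 is the orthogonal projection with respect to $\langle\cdot,\cdot\rangle_S$. The function $f$ is understood as (extended to) a smooth function on an open neighborhood of $\mathbb{S}_n^{\boldsymbol{\pi}}$ in $\mathbb{R}^{n\times n}$; $\mathrm{D}f(S)[\xi]=\lim_{t\to0}\frac{f(S+t\xi)-f(S)}{t}$ is the directional derivative, and $\operatorname{Grad}f(S)\in\mathbb{R}^{n\times n}$ is the Euclidean gradient: $\operatorname{Trace}(\operatorname{Grad}f(S)\,\xi^T)=\mathrm{D}f(S)[\xi]$ for all $\xi\in\mathbb{R}^{n\times n}$. The Riemannian gradient $\operatorname{grad}f(S)$ is the unique vector in $\mathcal{T}_S\mathbb{S}_n^{\boldsymbol{\pi}}$ satisfying $\langle\operatorname{grad}f(S),\xi_S\rangle_S=\mathrm{D}f(S)[\xi_S]$ for all $\xi_S\in\mathcal{T}_S\mathbb{S}_n^{\boldsymbol{\pi}}$. *)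

(* Defs.v *)
From HB Require Import structures.
From mathcomp Require Import all_boot all_order all_algebra.
From mathcomp Require Import all_classical all_reals all_analysis.
Set Implicit Arguments.
Unset Strict Implicit.
Unset Printing Implicit Defensive.

Import Order.TTheory GRing.Theory Num.Theory numFieldNormedType.Exports.
Local Open Scope classical_set_scope.
Local Open Scope ring_scope.

Definition ones {R : realType} (n : nat) : 'cV[R]_n := const_mx 1.

Definition hadamard {R : realType} {n : nat} (A B : 'M[R]_n) : 'M[R]_n :=
  map2_mx *%R A B.

(* w is the weight vector written pi in the mathematics: the identifier pi already
   denotes the real number in trigo. *)
Definition stoch {R : realType} {n : nat} (w : 'cV[R]_n) : set 'M[R]_n :=
  [set S | [/\ S *m ones n = ones n, w^T *m S = w^T & forall i j, 0 < S i j]].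

(* The tangent space does not depend on the base point S. *)
Definition tangent {R : realType} {n : nat} (w : 'cV[R]_n) : set 'M[R]_n :=
  [set xi | xi *m ones n = 0 /\ w^T *m xi = 0].

Definition fisher {R : realType} {n : nat} (S xi eta : 'M[R]_n) : R :=
  \sum_(i < n) \sum_(j < n) (xi i j * eta i j / S i j).

(* C^k on U: for k.+1, f is Frechet differentiable on U and all its directional
   derivatives are C^k on U. Meant for open U. *)
Fixpoint Ck {R : realType} {n : nat} (k : nat) (U : set 'M[R]_n)
    (f : 'M[R]_n -> R) : Prop :=
  if k is k'.+1 then
    (forall x, U x -> differentiable f x) /\ (forall v, Ck k' U ('D_v f))
  else forall x, U x -> {for x, continuous f}.

Definition smooth_on {R : realType} {n : nat} (U : set 'M[R]_n)
  (f : 'M[R]_n -> R) : Prop := forall k, Ck k U f.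

Definition is_euclid_grad {R : realType} {n : nat} (f : 'M[R]_n -> R)
    (S G : 'M[R]_n) : Prop :=
  forall xi : 'M[R]_n, \tr (G *m xi^T) = 'D_xi f S.

Definition is_riem_grad {R : realType} {n : nat} (w : 'cV[R]_n)
    (f : 'M[R]_n -> R) (S G : 'M[R]_n) : Prop :=
  tangent w G /\ forall xi, tangent w xi -> fisher S G xi = 'D_xi f S.

Definition is_fisher_proj {R : realType} {n : nat} (w : 'cV[R]_n)
    (S M P : 'M[R]_n) : Prop :=
  tangent w P /\ forall xi, tangent w xi -> fisher S (M - P) xi = 0.

(* The default value 0 of xget is never used when S > 0 and f is differentiable
   at S: see euclid_gradP, riem_gradP and fisher_projP, and the uniqueness lemmas. *)
Definition euclid_grad {R : realType} {n : nat} (f : 'M[R]_n -> R)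
  (S : 'M[R]_n) : 'M[R]_n := xget 0 [set G | is_euclid_grad f S G].

Definition riem_grad {R : realType} {n : nat} (w : 'cV[R]_n)
  (f : 'M[R]_n -> R) (S : 'M[R]_n) : 'M[R]_n :=
  xget 0 [set G | is_riem_grad w f S G].

Definition fisher_proj {R : realType} {n : nat} (w : 'cV[R]_n)
  (S M : 'M[R]_n) : 'M[R]_n := xget 0 [set P | is_fisher_proj w S M P].

Section WellDefined.
Context {R : realType} {n : nat}.
Implicit Types (w : 'cV[R]_n) (S xi eta G P M : 'M[R]_n) (f : 'M[R]_n -> R).

Lemma fisher_linl S eta a xi1 xi2 :
  fisher S (a *: xi1 + xi2) eta = a * fisher S xi1 eta + fisher S xi2 eta.
Proof.
rewrite /fisher mulr_sumr -big_split /=; apply: eq_bigr => i _.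
rewrite mulr_sumr -big_split /=; apply: eq_bigr => j _.
by rewrite !mxE !mulrDl !mulrA.
Qed.

Lemma fisherC S xi eta : fisher S xi eta = fisher S eta xi.
Proof.
by apply: eq_bigr => i _; apply: eq_bigr => j _; rewrite (mulrC (xi i j)).
Qed.

Lemma fisherBl S xi1 xi2 eta :
  fisher S (xi1 - xi2) eta = fisher S xi1 eta - fisher S xi2 eta.
Proof. by rewrite addrC -scaleN1r fisher_linl mulN1r addrC. Qed.

Lemma fisher_eq0 S xi : (forall i j, 0 < S i j) -> fisher S xi xi = 0 -> xi = 0.
Proof.
move=> S0 xi0.
have pos i j : 0 <= xi i j * xi i j / S i j.
  by rewrite divr_ge0 ?(ltW (S0 _ _))// -expr2 sqr_ge0.
apply/matrixP => i j; rewrite mxE.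
have := psumr_eq0P (fun i _ => sumr_ge0 _ (fun j _ => pos i j)) xi0 (i := i) isT.
move=> xii; have /eqP := psumr_eq0P (fun j _ => pos i j) xii (i := j) isT.
by rewrite !mulf_eq0 invr_eq0 (gt_eqF (S0 _ _)) orbF orbb => /eqP.
Qed.

Lemma tangent_lin w a xi eta :
  tangent w xi -> tangent w eta -> tangent w (a *: xi + eta).
Proof.
move=> [x1 x2] [e1 e2]; split.
  by rewrite mulmxDl -scalemxAl x1 e1 scaler0 addr0.
by rewrite mulmxDr -scalemxAr x2 e2 scaler0 addr0.
Qed.

Lemma tangentB w xi eta :
  tangent w xi -> tangent w eta -> tangent w (xi - eta).
Proof. by move=> x e; rewrite addrC -scaleN1r; apply: tangent_lin. Qed.

Lemma fisher_tangent_inj w S xi eta : (forall i j, 0 < S i j) ->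
  tangent w xi -> tangent w eta ->
  (forall z, tangent w z -> fisher S xi z = fisher S eta z) -> xi = eta.
Proof.
move=> S0 tx te xe; apply/subr0_eq/(fisher_eq0 S0).
by rewrite fisherBl xe ?subrr//; exact: tangentB.
Qed.

Lemma tangent_basis w : exists k (b : 'I_k -> 'M[R]_n),
  [/\ forall i, tangent w (b i),
      forall xi, tangent w xi -> exists c : 'rV[R]_k, xi = \sum_i c 0 i *: b i &
      forall c : 'rV[R]_k, \sum_i c 0 i *: b i = 0 -> c = 0].
Proof.
pose A := lin_mx (mulmxr (ones n) : 'M[R]_n -> 'M[R]_(n, 1)).
pose B := lin_mx (mulmx w^T : 'M[R]_n -> 'M[R]_(1, n)).
pose K := row_base (kermx (row_mx A B)).
have TK xi : tangent w xi <-> (mxvec xi <= K)%MS.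
  rewrite eq_row_base; split.
    move=> [x1 x2]; apply/sub_kermxP.
    by rewrite mul_mx_row !mul_vec_lin /= x1 x2 !linear0 row_mx0.
  move=> /sub_kermxP; rewrite mul_mx_row !mul_vec_lin /= -row_mx0.
  move=> /eq_row_mx[/(canRL mxvecK) x1 /(canRL mxvecK) x2].
  by split; rewrite ?x1 ?x2 linear0.
have sumK (c : 'rV[R]_(\rank (kermx (row_mx A B)))) :
    \sum_i c 0 i *: vec_mx (row i K) = vec_mx (c *m K).
  by rewrite mulmx_sum_row linear_sum; apply: eq_bigr => i _; rewrite linearZ.
exists _, (fun i => vec_mx (row i K)); split.
- by move=> i; apply/TK; rewrite vec_mxK row_sub.
- by move=> xi /TK/submxP[c cK]; exists c; rewrite sumK -cK mxvecK.
- move=> c; rewrite sumK => /(canRL vec_mxK); rewrite linear0 => cK0.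
  by apply: (row_free_inj (row_base_free _)); rewrite -/K cK0 mul0mx.
Qed.

Lemma riesz w S (l : 'M[R]_n -> R) : (forall i j, 0 < S i j) -> linear l ->
  exists2 G, tangent w G & forall xi, tangent w xi -> fisher S G xi = l xi.
Proof.
move=> S0 llin.
have [k [b [Tb spanb freeb]]] := tangent_basis w.
have lsum m (g : 'M[R]_n -> R) (c : 'I_m -> R) (v : 'I_m -> 'M[R]_n) :
    (forall a x y, g (a *: x + y) = a * g x + g y) ->
    g (\sum_i c i *: v i) = \sum_i c i * g (v i).
  move=> glin; apply: (big_ind2 (fun x y => g x = y)).
  - by have := glin (-1) 0 0; rewrite scaler0 addr0 mulN1r addNr.
  - by move=> x _ y _ <- <-; rewrite -[x]scale1r glin mul1r scale1r.
  - move=> i _; rewrite -[_ *: _]addr0 glin.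
    suff -> : g 0 = 0 by rewrite addr0.
    by have := glin (-1) 0 0; rewrite scaler0 addr0 mulN1r addNr.
have Tsum m (c : 'I_m -> R) (v : 'I_m -> 'M[R]_n) :
    (forall i, tangent w (v i)) -> tangent w (\sum_i c i *: v i).
  move=> Tv; apply: big_ind => //.
  - by split; rewrite ?mul0mx ?mulmx0.
  - by move=> x y Tx Ty; rewrite -[x]scale1r; exact: tangent_lin.
  - move=> i _; rewrite -[_ *: _]addr0; apply: tangent_lin => //.
    by split; rewrite ?mul0mx ?mulmx0.
pose Q := \matrix_(i, j) fisher S (b i) (b j).
have fisherQ (c : 'rV[R]_k) j : fisher S (\sum_i c 0 i *: b i) (b j) = (c *m Q) 0 j.
  rewrite (lsum _ (fun x => fisher S x (b j))); last by move=> *; exact: fisher_linl.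
  by rewrite !mxE; apply: eq_bigr => i _; rewrite mxE.
have Qu : Q \in unitmx.
  rewrite -row_free_unit -kermx_eq0; apply/rowV0P => c /sub_kermxP cQ.
  apply: freeb; apply: (fisher_eq0 S0).
  rewrite (lsum _ (fun x => fisher S x _)); last by move=> *; exact: fisher_linl.
  by rewrite big1// => j _; rewrite fisherC fisherQ cQ mxE mulr0.
pose c := (\row_i l (b i)) *m invmx Q.
exists (\sum_i c 0 i *: b i); first exact: Tsum.
move=> _ /spanb[d ->]; rewrite fisherC.
rewrite (lsum _ (fun x => fisher S x _)); last by move=> *; exact: fisher_linl.
rewrite (lsum _ l) //; apply: eq_bigr => j _.
by rewrite fisherC fisherQ /c mulmxKV// mxE.
Qed.

Lemma is_euclid_grad_unique f S G1 G2 :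
  is_euclid_grad f S G1 -> is_euclid_grad f S G2 -> G1 = G2.
Proof.
move=> h1 h2; apply/matrixP => i j.
have E G : \tr (G *m (delta_mx i j)^T) = G i j.
  rewrite trmx_delta /mxtrace (bigD1 i)//= big1 ?addr0 => [|k ki].
    rewrite mxE (bigD1 j)//= big1 ?addr0 => [|k kj]; rewrite mxE.
      by rewrite !eqxx mulr1.
    by rewrite (negbTE kj) mulr0.
  by rewrite mxE big1// => l _; rewrite mxE (negbTE ki) andbF mulr0.
by rewrite -(E G1) -(E G2) h1 h2.
Qed.

Lemma is_riem_grad_unique w f S G1 G2 : (forall i j, 0 < S i j) ->
  is_riem_grad w f S G1 -> is_riem_grad w f S G2 -> G1 = G2.
Proof.
move=> S0 [T1 h1] [T2 h2]; apply: (fisher_tangent_inj S0 T1 T2) => z Tz.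
by rewrite h1// h2.
Qed.

Lemma is_fisher_proj_unique w S M P1 P2 : (forall i j, 0 < S i j) ->
  is_fisher_proj w S M P1 -> is_fisher_proj w S M P2 -> P1 = P2.
Proof.
move=> S0 [T1 h1] [T2 h2]; apply: (fisher_tangent_inj S0 T1 T2) => z Tz.
have := h1 _ Tz; have := h2 _ Tz; rewrite !fisherBl.
by move=> /subr0_eq <- /subr0_eq.
Qed.

Lemma euclid_gradP f S : differentiable f S -> is_euclid_grad f S (euclid_grad f S).
Proof.
move=> df; suff ex : exists G, is_euclid_grad f S G
  by exact: (@xgetPex _ 0 (is_euclid_grad f S)).
exists (\matrix_(i, j) 'D_(delta_mx i j) f S) => xi.
rewrite [in RHS](matrix_sum_delta xi) deriveE// linear_sum /mxtrace.
apply: eq_bigr => i _; rewrite mxE linear_sum; apply: eq_bigr => j _.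
by rewrite linearZ /= !mxE deriveE// mulrC.
Qed.

Lemma riem_gradP w f S : (forall i j, 0 < S i j) -> differentiable f S ->
  is_riem_grad w f S (riem_grad w f S).
Proof.
move=> S0 df; suff ex : exists G, is_riem_grad w f S G
  by exact: (@xgetPex _ 0 (is_riem_grad w f S)).
have [|G TG hG] := @riesz w S (fun xi => 'D_xi f S) S0; last by exists G.
by move=> a x y; rewrite !deriveE// linearP.
Qed.

Lemma fisher_projP w S M : (forall i j, 0 < S i j) -> is_fisher_proj w S M (fisher_proj w S M).
Proof.
move=> S0; suff ex : exists G, is_fisher_proj w S M G
  by exact: (@xgetPex _ 0 (is_fisher_proj w S M)).
have [|G TG hG] := @riesz w S (fun xi => fisher S M xi) S0.
  by move=> a x y; rewrite ![fisher _ M _]fisherC fisher_linl.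
by exists G; split=> // xi Txi; rewrite fisherBl hG// subrr.
Qed.

End WellDefined.

(* Main.v *)
Require Import Defs.
From mathcomp Require Import all_boot all_order all_algebra.
From mathcomp Require Import all_classical all_reals all_analysis.
Import Order.TTheory GRing.Theory Num.Theory numFieldNormedType.Exports.
Local Open Scope classical_set_scope.
Local Open Scope ring_scope.

(** The Fisher metric divides entrywise by [S], so the Hadamard factor [S]
cancels: [<G . S, xi>_S = Trace (G xi^T)] for every matrix [xi]
([fisher_hadamard]).  For the Euclidean gradient [G] of [f] this is the
directional derivative of [f] along [xi].  Now the Fisher projection of [G . S]
is tangent and has the same Fisher product with tangent vectors as [G . S], so
it satisfies the conditions that define the Riemannian gradient, and these
determine it uniquely. *)

Lemma fisher_hadamard (R : realType) (n : nat) (S G xi : 'M[R]_n) :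
  (forall i j, S i j != 0) -> fisher S (hadamard G S) xi = \tr (G *m xi^T).
Proof.
move=> S_neq0; apply: eq_bigr => i _; rewrite mxE; apply: eq_bigr => j _.
by rewrite !mxE mulrAC mulfK.
Qed.

Theorem proposition4p4 (R : realType) (n : nat) (w : 'cV[R]_n)
    (w_gt0 : forall i, 0 < w i 0) (w_sum1 : w^T *m ones n = 1%:M)
    (f : 'M[R]_n -> R) (U : set 'M[R]_n) (U_open : open U)
    (stochU : stoch w `<=` U) (f_smooth : smooth_on U f)
    (S : 'M[R]_n) (stochS : stoch w S) :
  riem_grad w f S = fisher_proj w S (hadamard (euclid_grad f S) S).
Proof.
have [_ _ S_gt0] := stochS.
have S_neq0 i j : S i j != 0 by rewrite gt_eqF.
have f_diff : differentiable f S by have [+ _] := f_smooth 1; apply; exact: stochU.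
apply: (is_riem_grad_unique S_gt0 (riem_gradP w S_gt0 f_diff)).
have [tanP orthP] := fisher_projP w (hadamard (euclid_grad f S) S) S_gt0.
split=> // xi tan_xi; rewrite -(euclid_gradP f_diff) -(fisher_hadamard _ _ _ _ _ S_neq0).
by have := orthP _ tan_xi; rewrite fisherBl => /subr0_eq ->.
Qed.
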